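(* Let $M\in\mathbb{R}^{n\times n}$ and $M'\in\mathbb{R}^{n'\times n'}$ be irreducible nonnegative matrices such that $M\mathbf{1}_n=\rho\mathbf{1}_n$ and $M'\mathbf{1}_{n'}=\rho'\mathbf{1}_{n'}$. Let $\operatorname{spec}(M)=\{\rho,\lambda_2,\dots,\lambda_n\}$ and $\operatorname{spec}(M')=\{\rho',\lambda'_2,\dots,\lambda'_{n'}\}$. Then $$\operatorname{spec}(M\otimes\mathbb{J}_{n'}+\mathbb{J}_n\otimes M')=\{n\rho'+n'\rho,\ n'\lambda_2,\dots,n'\lambda_n,\ n\lambda'_2,\dots,n\lambda'_{n'},\ 0^{((n-1)(n'-1))}\}.$$
   Context: $\mathbf{1}_n$ is the all-ones vector of length $n$, $\mathbb{J}_n$ is the $n\times n$ all-ones matrix, and $\otimes$ is the Kronecker product. $\operatorname{spec}(A)$ is the multiset of complex eigenvalues of $A$, each repeated according to algebraic multiplicity; $x^{(m)}$ means that $x$ is listed $m$ times. *)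

(* Defs.v *)
From mathcomp Require Export all_boot all_order all_algebra perm.
From mathcomp Require Export reals.
From mathcomp.real_closed Require Export complex mxtens.

Set Implicit Arguments.
Unset Strict Implicit.
Unset Printing Implicit Defensive.

Export Order.TTheory GRing.Theory Num.Theory.

Local Open Scope ring_scope.

(* A multiset is represented by a sequence, multiset equality by [perm_eq].  *)
Definition spec (R : rcfType) n (A : 'M[R]_n) : seq R[i] :=
  sval (closed_field_poly_normal (char_poly (map_mx (real_complex R) A))).

Lemma char_poly_spec (R : rcfType) n (A : 'M[R]_n) :
  char_poly (map_mx (real_complex R) A) = \prod_(z <- spec A) ('X - z%:P).
Proof.
rewrite /spec; case: (closed_field_poly_normal _) => /= r {1}->.
by rewrite (monicP (char_poly_monic _)) scale1r.
Qed.

Definition nonneg_mx (R : numDomainType) m n (A : 'M[R]_(m, n)) : Prop :=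
  forall i j, 0 <= A i j.

(* The block in rows r, ..., n-1 and columns 0, ..., r-1 vanishes.           *)
Definition reducible_mx (R : pzRingType) n (A : 'M[R]_n) : Prop :=
  exists (s : 'S_n) (r : nat), (0 < r < n)%N /\
    forall i j : 'I_n, (r <= i)%N -> (j < r)%N ->
      (perm_mx s *m A *m (perm_mx s)^T) i j = 0.

(* With this convention every 1 x 1 matrix, including 0, is irreducible.     *)
Definition irreducible_mx (R : pzRingType) n (A : 'M[R]_n) : Prop :=
  ~ reducible_mx A.

Definition ones_cv (R : pzRingType) n : 'cV[R]_n := const_mx 1.

Definition ones_mx (R : pzRingType) n : 'M[R]_n := const_mx 1.

(* Main.v *)
Require Import Defs.
From mathcomp Require Import ring zify.

(** Constant row sums make the all-ones vector 1 an eigenvector of both factors,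
    which allows the eigenvalues rho and rho' to be deflated to 0 by rank-one
    updates.  Put M0 = M - (rho / n) J and M0' = M' - (rho' / n') J, so that
    M0 1 = 0 and M0' 1 = 0.  Then

      M (x) J + J (x) M' = N0 + (rho / n + rho' / n') J
      with  N0 = M0 (x) J + J (x) M0'  and  N0 1 = 0.

    Adding x v to a matrix that has x as an eigenvector for the value r only
    replaces r by r + v x in the spectrum ([char_poly_rank1_eigen], a theorem of
    Brauer).  Hence M0 has spectrum 0, lambda_2, ..., lambda_n, likewise M0',
    and the matrix of interest differs spectrally from N0 by exchanging one 0 for
    n n' (rho / n + rho' / n') = n rho' + n' rho.

    The matrix N0 has low rank: since J = 1 1^T, it factors as U V with

      U = (I (x) 1 | 1 (x) I)   and   V = (M0 (x) 1^T // 1^T (x) M0'),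

    and the product V U in the other order is diag (n' M0, n M0'), its
    off-diagonal blocks being multiples of M0 1 and M0' 1.  As U V and V U have
    the same characteristic polynomial up to a power of X ([char_poly_mulmxC]),
    the spectrum of N0 consists of that of n' M0, that of n M0', and zeros
    ([char_poly_kron_ones]).  Comparing degrees gives their number.

    All of this takes place over a field in which n and n' are nonzero
    ([char_poly_kron_sum_ones]); the theorem is the case of the complex numbers,
    where a characteristic polynomial determines the multiset of its roots. *)

Set Implicit Arguments.
Unset Strict Implicit.
Unset Printing Implicit Defensive.

Local Open Scope ring_scope.
Local Open Scope complex_scope.

(** The Schur complement of an identity block.  Both rank-reduction lemmas below
    come from evaluating the determinant of one bordered matrix twice: once
    here, once after a different elimination. *)
Lemma det_schur (R : comNzRingType) m n (A : 'M[R]_m) (B : 'M[R]_(m, n))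
    (C : 'M[R]_(n, m)) :
  \det (block_mx A B C 1%:M) = \det (A - B *m C).
Proof.
have := det_mulmx (block_mx A B C 1%:M) (block_mx 1%:M 0 (- C) 1%:M).
rewrite det_lblock !det1 !mulr1 => <-.
by rewrite mulmx_block !mulmx1 !mulmx0 !add0r mul1mx subrr det_ublock det1
  mulr1 mulmxN.
Qed.

(** Sylvester's identity.  Both sides are the determinant of
    (1 0 // -B X) (X A // B 1): the right factor alone gives [A *m B] by its
    Schur complement, whereas the product is upper triangular with diagonal
    blocks X and X - B A. *)
Lemma char_poly_mulmxC (R : comNzRingType) m n (A : 'M[R]_(m, n))
    (B : 'M[R]_(n, m)) :
  'X^n * char_poly (A *m B) = 'X^m * char_poly (B *m A).
Proof.
rewrite /char_poly /char_poly_mx !map_mxM -det_schur -(det_scalar n) -(det_scalar m).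
set a := map_mx _ A; set b := map_mx _ B.
have := det_lblock (1%:M : 'M_m) (- b) ('X : {poly R})%:M.
rewrite det1 mul1r => <-.
rewrite -det_mulmx mulmx_block !mul1mx !mul0mx !addr0 mulmx1.
by rewrite mulNmx scalar_mxC addNr mulNmx addrC det_ublock.
Qed.

(** Brauer's theorem on rank-one updates along an eigenvector.  The bordered
    matrix (X - A, x // v, 1) has determinant [char_poly (A + x *m v)]; multiplied
    on the right by (1, -x // 0, X - r) it becomes lower triangular, because
    (X - A) x = (X - r) x.  Writing the factor X - r on the left-hand side
    avoids division, so the statement holds over any commutative ring. *)
Lemma char_poly_rank1_eigen (R : comNzRingType) n (A : 'M[R]_n)
    (x : 'cV[R]_n) (v : 'rV[R]_n) (r : R) :
  A *m x = r *: x ->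
  char_poly (A + x *m v) * ('X - r%:P)
    = char_poly A * ('X - (r + (v *m x) 0 0)%:P).
Proof.
move=> Ax; rewrite /char_poly /char_poly_mx map_mxD map_mxM opprD addrA -det_schur.
set x' := map_mx _ x; set v' := map_mx _ v.
have Ax' : map_mx polyC A *m x' = r%:P *: x'.
  by rewrite -map_mxM Ax map_mxZ.
have := det_ublock (1%:M : 'M_n) (- x') (('X - r%:P)%:M : 'M_1).
rewrite det1 mul1r det_scalar1 => <-.
rewrite -det_mulmx mulmx_block !mulmx1 !mulmx0 !addr0 mul1mx.
rewrite mul_mx_scalar mulmxN mulmxBl mul_scalar_mx Ax' -scalerBl addNr det_lblock.
congr (_ * _); rewrite det_mx11 mulmxN -map_mxM !mxE rmorphD /= mulr1n; ring.
Qed.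

(** The identity det (X - c A) = c^n det (X / c - A) turns scaling the matrix into
    composing its characteristic polynomial with X / c. *)
Lemma char_poly_scale (F : fieldType) n (A : 'M[F]_n) (c : F) (s : seq F) :
  c != 0 -> char_poly A = \prod_(z <- s) ('X - z%:P) ->
  char_poly (c *: A) = \prod_(z <- [seq c * z | z <- s]) ('X - z%:P).
Proof.
move=> c0 As.
have szs : size s = n.
  by apply/eqP; rewrite -eqSS -(size_prod_XsubC s id) -As size_char_poly.
have -> : char_poly (c *: A) = c ^+ n *: (char_poly A \Po (c^-1 *: 'X)).
  rewrite -mul_polyC rmorphXn /= -det_scalar /char_poly.
  rewrite -(det_map_mx (comp_poly (c^-1 *: 'X))) -det_mulmx mul_scalar_mx.
  congr (\det _); apply/matrixP=> i j; rewrite !mxE.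
  rewrite rmorphB /= rmorphMn /= comp_polyX comp_polyC mulrBr mulrnAr mul_polyC.
  by rewrite scalerA mulfV // scale1r rmorphM.
rewrite As -szs big_map; elim: s {As szs} => [|z s IHs].
  by rewrite !big_nil rmorph1 scale1r.
rewrite !big_cons -IHs rmorphM /= exprS -scalerA scalerAr scalerAl.
congr (_ * _); rewrite rmorphB /= comp_polyX comp_polyC.
by rewrite scalerBr scalerA mulfV // scale1r -mul_polyC rmorphM.
Qed.

Lemma char_poly_castmx (R : nzRingType) m n (e : m = n) (A : 'M[R]_m) :
  char_poly (castmx (e, e) A) = char_poly A.
Proof. by case: n / e. Qed.

Lemma char_poly_ublock (R : comNzRingType) m n (A : 'M[R]_m) (B : 'M[R]_n) :
  char_poly (block_mx A 0 0 B) = char_poly A * char_poly B.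
Proof.
rewrite /char_poly /char_poly_mx map_block_mx !map_mx0 scalar_mx_block.
by rewrite opp_block_mx add_block_mx !oppr0 !addr0 det_ublock.
Qed.

(** Brauer's theorem with x = 1 and v = - a 1^T, where a is chosen so that
    v x = - r: the eigenvalue r moves to 0 and the others stay. *)
Lemma char_poly_deflate_ones (F : fieldType) n (A : 'M[F]_n) (r a : F) (p : {poly F}) :
  A *m ones_cv F n = r *: ones_cv F n -> n%:R * a = r ->
  char_poly A = ('X - r%:P) * p ->
  char_poly (A - a *: ones_mx F n) = 'X * p.
Proof.
move=> A1 na Ap.
have JE : - (a *: ones_mx F n) = ones_cv F n *m const_mx (- a).
  by apply/matrixP=> i j; rewrite !mxE big_ord1 !mxE mulr1 mul1r.
apply: (@mulIf _ ('X - r%:P)); first by rewrite polyXsubC_eq0.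
rewrite JE (char_poly_rank1_eigen _ A1) Ap mxE.
under eq_bigr do rewrite !mxE mulr1.
rewrite sumr_const card_ord mulNrn -[a *+ n]mulr_natl na subrr subr0; ring.
Qed.

Lemma mul_deflate_ones (F : fieldType) n (A : 'M[F]_n) (r a : F) :
  A *m ones_cv F n = r *: ones_cv F n -> n%:R * a = r ->
  (A - a *: ones_mx F n) *m ones_cv F n = 0.
Proof.
move=> A1 na; rewrite mulmxBl A1; apply/matrixP=> i j; rewrite !mxE.
under eq_bigr do rewrite !mxE !mulr1.
by rewrite sumr_const card_ord -[a *+ n]mulr_natl na mulr1 subrr.
Qed.

(** For factors that annihilate 1, the Kronecker combination is U V with V U block
    diagonal, so Sylvester's identity splits its characteristic polynomial. *)
Lemma char_poly_kron_ones (F : fieldType) n n' (A : 'M[F]_n) (B : 'M[F]_n') :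
  A *m ones_cv F n = 0 -> B *m ones_cv F n' = 0 ->
  'X^(n + n') * char_poly (A *t ones_mx F n' + ones_mx F n *t B)
    = 'X^(n * n') * (char_poly (n'%:R *: A) * char_poly (n%:R *: B)).
Proof.
move=> A1 B1.
have J k : ones_mx F k = ones_cv F k *m (ones_cv F k)^T.
  by apply/matrixP=> i j; rewrite !mxE big_ord1 !mxE mulr1.
have S k : (ones_cv F k)^T *m ones_cv F k = k%:R%:M.
  apply/matrixP=> i j; rewrite !ord1 !mxE mulr1n.
  under eq_bigr do rewrite !mxE mulr1.
  by rewrite sumr_const card_ord.
pose U := row_mx (1%:M *t ones_cv F n') (ones_cv F n *t 1%:M).
pose V := col_mx (A *t (ones_cv F n')^T) ((ones_cv F n)^T *t B).
have -> : A *t ones_mx F n' + ones_mx F n *t B = U *m V.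
  by rewrite mul_row_col !tensmx_mul !mul1mx -!J.
(* The off-diagonal blocks of V U are A 1 (x) 1^T and 1^T (x) B 1. *)
have <- : char_poly (V *m U) = char_poly (n'%:R *: A) * char_poly (n%:R *: B).
  rewrite mul_col_row !tensmx_mul !mulmx1 A1 B1 !S tens0mx tensmx0.
  by rewrite char_poly_ublock tens_mx_scalar tens_scalar_mx !char_poly_castmx.
(* The two blocks of U have n * 1 and 1 * n' columns. *)
have -> : 'X^(n + n') = 'X^(n * 1 + 1 * n') :> {poly F} by rewrite muln1 mul1n.
exact: char_poly_mulmxC.
Qed.

(** Row sums r and r' contribute r / n + r' / n' times the all-ones matrix on top
    of the deflated factors; since the deflated combination kills the all-ones
    vector, Brauer's theorem accounts for this contribution. *)
Lemma char_poly_kron_sum_ones (F : fieldType) n n' (A : 'M[F]_n) (B : 'M[F]_n')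
    (r r' : F) (s s' : seq F) :
  n%:R != 0 :> F -> n'%:R != 0 :> F ->
  A *m ones_cv F n = r *: ones_cv F n ->
  B *m ones_cv F n' = r' *: ones_cv F n' ->
  char_poly A = \prod_(z <- r :: s) ('X - z%:P) ->
  char_poly B = \prod_(z <- r' :: s') ('X - z%:P) ->
  char_poly (A *t ones_mx F n' + ones_mx F n *t B)
    = \prod_(z <- (n%:R * r' + n'%:R * r) :: [seq n'%:R * x | x <- s]
              ++ [seq n%:R * x | x <- s'] ++ nseq ((n - 1) * (n' - 1)) 0)
        ('X - z%:P).
Proof.
move=> n0 n'0 A1 B1; rewrite !big_cons => As Bs.
pose a := n%:R^-1 * r; pose b := n'%:R^-1 * r'.
have na : n%:R * a = r by rewrite mulrA mulfV // mul1r.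
have nb : n'%:R * b = r' by rewrite mulrA mulfV // mul1r.
pose A0 := A - a *: ones_mx F n; pose B0 := B - b *: ones_mx F n'.
have A01 : A0 *m ones_cv F n = 0 by apply: mul_deflate_ones A1 na.
have B01 : B0 *m ones_cv F n' = 0 by apply: mul_deflate_ones B1 nb.
pose P := \prod_(z <- [seq n'%:R * x | x <- s]) ('X - z%:P).
pose Q := \prod_(z <- [seq n%:R * x | x <- s']) ('X - z%:P).
have A0s : char_poly (n'%:R *: A0) = 'X * P.
  rewrite (@char_poly_scale _ _ _ _ (0 :: s)) //= ?big_cons ?mulr0 ?subr0 //.
  exact: char_poly_deflate_ones A1 na As.
have B0s : char_poly (n%:R *: B0) = 'X * Q.
  rewrite (@char_poly_scale _ _ _ _ (0 :: s')) //= ?big_cons ?mulr0 ?subr0 //.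
  exact: char_poly_deflate_ones B1 nb Bs.
pose N0 := A0 *t ones_mx F n' + ones_mx F n *t B0.
have NE : A *t ones_mx F n' + ones_mx F n *t B
    = N0 + ones_cv F (n * n') *m const_mx (a + b).
  apply/matrixP=> i j; case: (mxtens_indexP i) => i1 i2.
  case: (mxtens_indexP j) => j1 j2.
  rewrite [LHS]mxE [RHS]mxE [N0 _ _]mxE !tensmxE !mxE big_ord1 !mxE; ring.
have N01 : N0 *m ones_cv F (n * n') = 0 *: ones_cv F (n * n').
  have T C D : (C *t D) *m ones_cv F (n * n')
      = (C *m ones_cv F n) *t (D *m ones_cv F n') :> 'cV_(n * n').
    rewrite -tensmx_mul; congr (_ *m _).
    by apply/matrixP=> i j; rewrite !mxE mulr1.
  by rewrite mulmxDl !T A01 B01 tens0mx tensmx0 addr0 scale0r.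
(* [N0s] and [Ns] determine the characteristic polynomial up to powers of X. *)
have := char_poly_kron_ones A01 B01; rewrite -/N0 A0s B0s => N0s.
have := char_poly_rank1_eigen (const_mx (a + b)) N01; rewrite -NE.
set N := char_poly (_ + _).
have -> : ((const_mx (a + b) : 'rV_(n * n')) *m ones_cv F (n * n')) 0 0
    = n%:R * r' + n'%:R * r.
  rewrite mxE; under eq_bigr do rewrite !mxE mulr1.
  rewrite sumr_const card_ord -[LHS]mulr_natl natrM -na -nb; ring.
rewrite subr0 add0r => Ns.
have n_gt0 : (0 < n)%N by rewrite lt0n; apply: contraNneq n0 => ->.
have n'_gt0 : (0 < n')%N by rewrite lt0n; apply: contraNneq n'0 => ->.
rewrite !big_cat /= big_nseq subr0 -/P -/Q iter_mulr_1.
have X0 : 'X^((n + n').+1) != 0 :> {poly F} by rewrite expf_neq0 ?polyX_eq0.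
apply: (mulfI X0).
set x := 'X - _.
have -> : 'X^((n + n').+1) * N = 'X^(n + n') * char_poly N0 * x.
  by rewrite -mulrA -Ns exprS; ring.
rewrite N0s.
transitivity ('X^((n * n').+2) * (P * Q * x)); first by rewrite !exprS; ring.
(* This is where both sizes have to be positive: the subtractions truncate. *)
have -> : ((n * n').+2 = (n + n').+1 + (n - 1) * (n' - 1))%N by nia.
by rewrite exprD; ring.
Qed.

Theorem corollary2p6 (R : realType) (n n' : nat)
    (M : 'M[R]_n) (M' : 'M[R]_n') (rho rho' : R) (lam lam' : seq R[i])
    (M_irr : irreducible_mx M) (M'_irr : irreducible_mx M')
    (M_ge0 : nonneg_mx M) (M'_ge0 : nonneg_mx M')
    (M_ones : M *m ones_cv R n = rho *: ones_cv R n)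
    (M'_ones : M' *m ones_cv R n' = rho' *: ones_cv R n')
    (specM : perm_eq (spec M) (rho%:C :: lam))
    (specM' : perm_eq (spec M') (rho'%:C :: lam')) :
  perm_eq (spec (M *t ones_mx R n' + ones_mx R n *t M'))
    ((n%:R * rho' + n'%:R * rho)%:C
       :: [seq n'%:R * x | x <- lam] ++ [seq n%:R * x | x <- lam']
       ++ nseq ((n - 1) * (n' - 1)) 0).
Proof.
have onesC k : map_mx (real_complex R) (ones_cv R k) = ones_cv R[i] k.
  by rewrite map_const_mx rmorph1.
have onesJC k : map_mx (real_complex R) (ones_mx R k) = ones_mx R[i] k.
  by rewrite map_const_mx rmorph1.
have rowsumC k (A : 'M[R]_k) r : A *m ones_cv R k = r *: ones_cv R k ->
    map_mx (real_complex R) A *m ones_cv R[i] k = r%:C *: ones_cv R[i] k.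
  by move=> A1; rewrite -onesC -map_mxM A1 map_mxZ.
have char_spec k (A : 'M[R]_k) t : perm_eq (spec A) t ->
    char_poly (map_mx (real_complex R) A) = \prod_(z <- t) ('X - z%:P).
  by move=> At; rewrite char_poly_spec (perm_big t).
(* An empty matrix has an empty spectrum, so both sizes are positive. *)
have size_neq0 k (A : 'M[R]_k) z t : perm_eq (spec A) (z :: t) ->
    k%:R != 0 :> R[i].
  move=> /char_spec /(congr1 (fun p : {poly R[i]} => size p)).
  rewrite size_char_poly size_prod_XsubC => -[->].
  by rewrite pnatr_eq0.
apply: prod_XsubC_eq; rewrite -char_poly_spec map_mxD !map_mxT !onesJC.
rewrite rmorphD !rmorphM !rmorph_nat.
apply: char_poly_kron_sum_ones; eauto.
Qed.
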